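(* Consider permutations $\sigma$ and $\tau$ and let $\tau=\tau_1\oplus\cdots\oplus\tau_t$ be the finest decomposition of $\tau$. Then $$\mu(\sigma,\tau)=\sum_{\sigma=\varsigma_1\oplus\cdots\oplus\varsigma_t}\ \prod_{1\le m\le t}\begin{cases}\mu(\varsigma_m,\tau_m)+1 & \text{if } \varsigma_m=\emptyset \text{ and } \tau_{m-1}=\tau_m,\\ \mu(\varsigma_m,\tau_m) & \text{otherwise,}\end{cases}$$ where the sum is over all direct sums $\sigma=\varsigma_1\oplus\cdots\oplus\varsigma_t$ such that $\emptyset\le\varsigma_m\le\tau_m$ for all $1\le m\le t$. The condition $\tau_{m-1}=\tau_m$ is considered false when $m=1$.
   Context: Permutations (of $\{1,\dots,n\}$, written as words) are ordered by pattern containment: $\sigma\le\tau$ if $\tau$ has a subsequence whose letters appear in the same relative order of size as those of $\sigma$. Here $\emptyset$ denotes the unique permutation of length $0$, which is included as the bottom element of the poset. $\mu$ denotes the Möbius function of this poset: $\mu(\sigma,\sigma)=1$, $\mu(\sigma,\tau)=-\sum_{\sigma\le\pi<\tau}\mu(\sigma,\pi)$ for $\sigma<\tau$, and $\mu(\sigma,\tau)=0$ if $\sigma\not\le\tau$. The direct sum $\alpha\oplus\beta$ is the concatenation of $\alpha$ and $\beta'$, where $\beta'$ is obtained from $\beta$ by adding to each of its letters the largest letter of $\alpha$ (so $\emptyset\oplus\beta=\beta$ and $\alpha\oplus\emptyset=\alpha$). A permutation is indecomposable if it is nonempty and is not the direct sum of two nonempty permutations. The finest decomposition of a nonempty permutation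 is its unique expression as a direct sum of indecomposable permutations. In the sum, the $\varsigma_m$ may be empty and need not be indecomposable. *)

(* Defs.v *)
From HB Require Import structures.
From mathcomp Require Import all_boot all_order all_algebra.

Set Implicit Arguments.
Unset Strict Implicit.
Unset Printing Implicit Defensive.

Import Order.TTheory GRing.Theory.
Local Open Scope nat_scope.

(* A permutation of length n is a word in which each of the letters 1, ..., n
   occurs exactly once; [permword] gathers the permutations of all lengths. *)
Record permword := PermWord {
  word :> seq nat;
  word_perm : perm_eq word (iota 1 (size word))
}.

HB.instance Definition _ := [isSub for word].
HB.instance Definition _ := [Countable of permword by <:].

Definition emptyp : permword := @PermWord [::] isT.

(* The letters of u and v appear in the same relative order of size. *)
Definition order_iso (u v : seq nat) : bool :=
  (size u == size v) &&
  [forall i : 'I_(size u), forall j : 'I_(size u),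
     (nth 0 u i < nth 0 u j) == (nth 0 v i < nth 0 v j)].

(* The subsequences of t are the words [mask m t]; see [containedP]. *)
Definition contained (s t : permword) : bool :=
  [exists m : (size t).-tuple bool, order_iso s (mask m t)].

Lemma order_isoP u v :
  reflect (size u = size v /\
           forall i j, i < size u -> j < size u ->
             (nth 0 u i < nth 0 u j) = (nth 0 v i < nth 0 v j))
          (order_iso u v).
Proof.
apply: (iffP andP) => [[/eqP es /forallP h]|[es h]]; split => //.
- by move=> i j hi hj; have /forallP/(_ (Ordinal hj))/eqP := h (Ordinal hi).
- by apply/eqP.
- by apply/forallP => i; apply/forallP => j; apply/eqP/h.
Qed.

Lemma containedP (s t : permword) :
  reflect (exists2 u : seq nat, subseq u t & order_iso s u) (contained s t).
Proof.
apply: (iffP existsP) => [[m hm]|[u /subseqP[m sm ->] h]].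
  by exists (mask m t) => //; apply: mask_subseq.
by exists (tcast sm (in_tuple m)); rewrite val_tcast.
Qed.

Lemma mask_nthE m (u : seq nat) :
  mask m u = [seq nth 0 u i | i <- mask m (iota 0 (size u))].
Proof. by rewrite map_mask -[in LHS](mkseq_nth 0 u). Qed.

Lemma order_iso_refl u : order_iso u u.
Proof. by apply/order_isoP. Qed.

Lemma order_iso_trans : transitive order_iso.
Proof.
move=> v u w /order_isoP[e1 h1] /order_isoP[e2 h2]; apply/order_isoP.
by split=> [|i j hi hj]; rewrite ?e1 // h1 // h2 // -e1.
Qed.

Lemma order_iso_mask m u v : order_iso u v -> order_iso (mask m u) (mask m v).
Proof.
move=> /order_isoP[es h]; rewrite (mask_nthE m u) (mask_nthE m v) -es.
set I := mask m _; apply/order_isoP; split; first by rewrite !size_map.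
rewrite size_map => i j hi hj.
have ltI k : k < size I -> nth 0 I k < size u.
  move=> /(mem_nth 0) /mem_mask; by rewrite mem_iota add0n.
by rewrite !(nth_map 0) // h ?ltI.
Qed.

Lemma count_lt_iota n k : 0 < k <= n -> count (gtn k) (iota 1 n) = k.-1.
Proof.
move=> /andP[k0 kn].
have -> : n = k.-1 + (n - k.-1) by rewrite subnKC // (leq_trans (leq_pred k)).
rewrite iotaD count_cat.
have -> : count (gtn k) (iota 1 k.-1) = k.-1.
  rewrite -[RHS](size_iota 1) -[LHS]/(count _ _); apply/eqP; rewrite -all_count.
  by apply/allP => x; rewrite mem_iota add1n prednK //= => /andP[].
rewrite -[in RHS](addn0 k.-1); congr (_ + _); apply/eqP.
rewrite eqn0Ngt -has_count; apply/hasPn => x.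
by rewrite mem_iota add1n prednK //= => /andP[kx _]; rewrite -leqNgt.
Qed.

Lemma permword_rank (s : permword) i : i < size s ->
  nth 0 s i = (count (fun j => nth 0 s j < nth 0 s i) (iota 0 (size s))).+1.
Proof.
move=> hi; have hs := word_perm s; set k := nth 0 s i.
have : k \in iota 1 (size s) by rewrite -(perm_mem hs) mem_nth.
rewrite mem_iota add1n ltnS => hk; have /andP[k0 _] := hk.
have /(_ (gtn k)) := permP hs; rewrite count_lt_iota // => e.
rewrite -[LHS]prednK // -e; congr _.+1.
by rewrite -[in LHS](mkseq_nth 0 s) count_map.
Qed.

Lemma order_iso_eq (s t : permword) : order_iso s t -> s = t.
Proof.
move=> /order_isoP[es h]; apply: val_inj; apply: (@eq_from_nth _ 0) => //= i hi.
rewrite permword_rank // [RHS]permword_rank -?es //; congr _.+1.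
by apply: eq_in_count => j; rewrite mem_iota add0n /= => hj; apply: h.
Qed.

Lemma contained_size s t : contained s t -> size s <= size t.
Proof. by move=> /containedP[u /size_subseq su /order_isoP[-> _]]. Qed.

Lemma contained_refl : reflexive contained.
Proof. by move=> s; apply/containedP; exists s => //; apply: order_iso_refl. Qed.

Lemma contained_anti : antisymmetric contained.
Proof.
move=> s t /andP[st /contained_size ts].
have /containedP[u ut su] := st.
have [es _] := order_isoP _ _ su.
suff eu : u = t by apply: order_iso_eq; rewrite eu in su.
apply/eqP; rewrite -(size_subseq_leqif ut) eqn_leq (size_subseq ut) /=.
by rewrite -es.
Qed.

Lemma contained_trans : transitive contained.
Proof.
move=> t s r /containedP[u /subseqP[m _ ->] su] /containedP[v vr tv].
apply/containedP; exists (mask m v); first exact: subseq_trans (mask_subseq _ _) vr.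
exact: order_iso_trans su (order_iso_mask m tv).
Qed.

Fact pattern_display : Order.disp_t. Proof. exact: Order.Disp tt tt. Qed.

HB.instance Definition _ :=
  Order.Le_isPOrder.Build pattern_display permword
    contained_refl contained_anti contained_trans.

(* All the permutations of length k. *)
Definition permwords (k : nat) : seq permword :=
  pmap insub (permutations (iota 1 k)).

Lemma mem_permwords k (s : permword) : (s \in permwords k) = (size s == k).
Proof.
rewrite mem_pmap_sub mem_permutations; apply/idP/eqP.
  by move=> /perm_size; rewrite size_iota.
by move=> <-; apply: word_perm.
Qed.

Lemma uniq_permwords k : uniq (permwords k).
Proof. by rewrite pmap_sub_uniq ?permutations_uniq. Qed.

(* The finite interval of all the permutations contained in t. *)
Definition down (t : permword) : seq permword :=
  [seq s <- flatten [seq permwords k | k <- iota 0 (size t).+1]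
    | (s <= t)%O].

Lemma mem_down s t : (s \in down t) = (s <= t)%O.
Proof.
rewrite mem_filter andb_idr // => st; apply/flatten_mapP; exists (size s).
  by rewrite mem_iota ltnS contained_size.
by rewrite mem_permwords.
Qed.

Lemma uniq_down t : uniq (down t).
Proof.
apply/filter_uniq; elim: (iota 0 _) (iota_uniq 0 (size t).+1) => //= k ks IH.
move=> /andP[kks uks]; rewrite cat_uniq uniq_permwords IH // andbT.
apply/hasPn => s /flatten_mapP[j jks]; rewrite !mem_permwords => /eqP ->.
by apply: contraNneq kks => <-.
Qed.

Lemma size_lt s t : (s < t :> permword)%O -> size s < size t.
Proof.
move=> st; have st' : contained s t by apply: (ltW st).
rewrite ltn_neqAle (contained_size st') andbT.
apply: contraTneq st => es; have /containedP[u ut su] := st'.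
have [e _] := order_isoP _ _ su.
suff eu : u = t by rewrite eu in su; rewrite (order_iso_eq su) ltxx.
by apply/eqP; rewrite -(size_subseq_leqif ut) -e es.
Qed.

Section Mobius.
Local Open Scope ring_scope.

Fixpoint mobius_rec (n : nat) (s t : permword) : int :=
  if n is n'.+1 then
    if s == t then 1
    else if (s <= t)%O then
      - \sum_(p <- down t | (s <= p < t)%O) mobius_rec n' s p
    else 0
  else 0.

(* The first argument of [mobius_rec] only bounds the depth of the recursion;
   [mobiusxx], [mobius_lt] and [mobius_nle] are the defining equations. *)
Definition mobius (s t : permword) : int := mobius_rec (size t).+1 s t.

Lemma mobius_recE n s (t : permword) : (size t < n)%N -> mobius_rec n s t = mobius s t.
Proof.
rewrite /mobius; move: {2}(size t).+1 (ltnSn (size t)) => m.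
elim: m n t => // m IH [|n] t //; rewrite !ltnS => tm tn /=.
case: eqP => // _; case: ifP => // _; congr (- _).
apply: eq_bigr => p /andP[_ /size_lt pt].
by rewrite !(IH _ p) //; apply: leq_trans pt _.
Qed.

Lemma mobiusxx s : mobius s s = 1.
Proof. by rewrite /mobius /= eqxx. Qed.

Lemma mobius_lt s t : (s < t)%O ->
  mobius s t = - \sum_(p <- down t | (s <= p < t)%O) mobius s p.
Proof.
move=> st; rewrite {1}/mobius /= lt_eqF // ltW //; congr (- _).
by apply: eq_bigr => p /andP[_ /size_lt pt]; rewrite mobius_recE.
Qed.

Lemma mobius_nle s t : ~~ (s <= t)%O -> mobius s t = 0.
Proof.
move=> st; rewrite /mobius /= (negbTE st).
by case: eqP st => // ->; rewrite lexx.
Qed.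

End Mobius.

Lemma max_letter (s : permword) : \max_(x <- s) x = size s.
Proof.
rewrite (perm_big _ (word_perm s)) /=; elim: (size s) => [|n IH].
  by rewrite big_nil.
rewrite -(addn1 n) iotaD big_cat /= IH big_seq1 add1n addn1.
exact/maxn_idPr.
Qed.

Definition sum_word (u v : seq nat) : seq nat :=
  u ++ [seq x + \max_(y <- u) y | x <- v].

Lemma sum_word_perm (a b : permword) :
  perm_eq (sum_word a b) (iota 1 (size (sum_word a b))).
Proof.
rewrite /sum_word max_letter size_cat size_map iotaD perm_cat ?word_perm //.
rewrite addnC iotaDl (eq_map (addnC^~ _)); exact/perm_map/word_perm.
Qed.

Definition dsum (a b : permword) : permword := PermWord (sum_word_perm a b).

Definition dsums (ss : seq permword) : permword := foldr dsum emptyp ss.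

Definition indecomposable (s : permword) : Prop :=
  s <> emptyp /\
  ~ exists a b : permword, [/\ a <> emptyp, b <> emptyp & s = dsum a b].

Definition finest_decomposition (t : permword) (ts : seq permword) : Prop :=
  t = dsums ts /\ (forall s, s \in ts -> indecomposable s).

(* All the sequences [:: s_1; ...; s_k] with s_m <= t_m for every m, where
   ts = [:: t_1; ...; t_k], without repetition. *)
Fixpoint down_seqs (ts : seq permword) : seq (seq permword) :=
  if ts is t :: ts' then [seq s :: ss | s <- down t, ss <- down_seqs ts']
  else [:: [::]].

Lemma mem_down_seqs ss ts :
  (ss \in down_seqs ts) = all2 (fun s t => s <= t)%O ss ts.
Proof.
elim: ts ss => [|t ts IH] [|s ss] //=.
  by apply/negP => /allpairsP[[? ?] /= [_ _]].
rewrite -mem_down -IH; apply/allpairsP/andP => [[[x y] /= [hx hy [-> ->]]]|[]] //.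
by exists (s, ss).
Qed.

Lemma uniq_down_seqs ts : uniq (down_seqs ts).
Proof.
elim: ts => //= t ts IH; apply: allpairs_uniq => //; first exact: uniq_down.
by move=> [? ?] [? ?] _ _ /= [-> ->].
Qed.

(* Main.v *)
Require Import Defs.
From mathcomp Require Import all_boot all_order all_algebra.
From Stdlib Require Import Classical.

Import Order.TTheory GRing.Theory.

Local Open Scope ring_scope.

(** Write [p <= s] for the 0/1 value of containment.  The function
    s |-> mobius s tau is characterized by the dual Moebius equations
    sum_s mobius s tau * [p <= s] = [p = tau], one for each p
    ([mobius_unique]), so it suffices to check them for the right-hand side.
    After exchanging sums, what has to be computed is the sum of
    (product of the factors) * [p <= s_1 + ... + s_t] over all the sequences
    s_1 <= tau_1, ..., s_t <= tau_t ([zeta_weights]).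

    Write p = p_1 + ... + p_k with indecomposable p_i.  An occurrence of p in a
    direct sum s + r cuts p into a prefix contained in s and a suffix contained
    in r, and the cut falls between two of the p_i.  For a fixed r, the best cut
    leaves to r as much as r can contain; [p <= s + r] then becomes
    [p_1 + ... + p_j <= s] with j depending on r only.  Summed against
    mobius s t for an indecomposable t, this is [p_1 + ... + p_j = t] by the
    dual Moebius equations, so it vanishes unless j = 1 and p_1 = t.  In other
    words ([zeta_mobius_dsum]), summing over the summand below t either gives 0
    or, if p_1 = t, gives the difference between the sums for p_2 + ... + p_k
    and for p.  An extra +1 at the empty summand adds the sum for p itself.

    Reading tau_1, ..., tau_t from left to right therefore acts linearly on the
    suffixes of p.  After tau_1 = p_1, ..., tau_m = p_m, the state is the
    difference of the last two suffixes, the one after p_m minus the one after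
    p_(m-1).  The next summand u = tau_(m+1) sends the first suffix to the wanted
    new difference if p_(m+1) = u and to 0 otherwise, but it also acts on the
    second one if p_m = u: the unwanted term is exactly what the extra +1, which
    is present when tau_m = u, cancels ([zeta_weights_telescope]).  At the end
    the difference is [p = tau]. *)

(** * The monoid of permutations under direct sum *)

Lemma word_inj (a b : permword) : word a = word b -> a = b.
Proof. exact: val_inj. Qed.

Lemma word_dsum (a b : permword) :
  word (dsum a b) = (word a ++ [seq (x + size a)%N | x <- word b])%SEQ.
Proof. by rewrite /= /sum_word max_letter. Qed.

Lemma size_dsum (a b : permword) : size (dsum a b) = (size a + size b)%N.
Proof. by rewrite word_dsum size_cat size_map. Qed.

Lemma size_eq0_emptyp (a : permword) : (size a == 0%N) = (a == emptyp).
Proof.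
apply/idP/eqP => [/nilP|-> //] e.
by apply: word_inj; rewrite e.
Qed.

Lemma dsum0p (a : permword) : dsum emptyp a = a.
Proof.
apply: word_inj; rewrite word_dsum /= -[RHS]map_id.
by apply: eq_map => x; rewrite addn0.
Qed.

Lemma dsump0 (a : permword) : dsum a emptyp = a.
Proof. by apply: word_inj; rewrite word_dsum /= cats0. Qed.

Lemma dsumA : associative dsum.
Proof.
move=> a b c; apply: word_inj; rewrite !word_dsum size_cat size_map.
rewrite map_cat -catA -map_comp; congr (_ ++ (_ ++ _))%SEQ.
by apply: eq_map => x /=; rewrite -addnA (addnC (size b)).
Qed.

Lemma dsumpI (a b c : permword) : dsum a b = dsum a c -> b = c.
Proof.
move=> /(congr1 word)/eqP; rewrite !word_dsum eqseq_cat // eqxx /= => /eqP e.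
by apply/word_inj/(inj_map (@addIn (size a))).
Qed.

Lemma dsums_cat (us vs : seq permword) :
  dsums (us ++ vs) = dsum (dsums us) (dsums vs).
Proof. by elim: us => [|u us IH] /=; rewrite ?dsum0p // IH dsumA. Qed.

Lemma mem_permword (p : permword) x : (x \in word p) = (0 < x <= size p)%N.
Proof. by rewrite (perm_mem (word_perm p)) mem_iota add1n ltnS. Qed.

(** The letters of a permutation being 1, ..., n, a prefix all of whose letters
    are below the rest must consist of the smallest ones: comparing the sorted
    word with that of the two parts shows that both are permutations up to a
    shift. *)
Lemma split_dsum (p : permword) (u v : seq nat) :
  word p = (u ++ v)%SEQ -> (forall x y, x \in u -> y \in v -> (x < y)%N) ->
  exists a b : permword, word a = u /\ p = dsum a b.
Proof.
move=> epuv ltuv.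
have es : (sort leq u ++ sort leq v)%SEQ = iota 1 (size u + size v)%N.
  apply: (@sorted_eq _ leq leq_trans anti_leq).
  - rewrite (sorted_pairwise leq_trans) pairwise_cat -!(sorted_pairwise leq_trans).
    rewrite !(sort_sorted leq_total) !andbT.
    apply/allrelP => x y; rewrite !mem_sort => xu yv.
    exact/ltnW/ltuv.
  - exact: iota_sorted.
  - rewrite -size_cat -epuv -(permPr (word_perm p)) epuv.
    by apply: perm_cat; rewrite perm_sort.
have /eqP := es; rewrite iotaD eqseq_cat ?size_sort ?size_iota // => /andP[/eqP eu /eqP ev].
have pu : perm_eq u (iota 1 (size u)) by rewrite -eu perm_sym perm_sort.
have pv : perm_eq v (iota (1 + size u)%N (size v)) by rewrite -ev perm_sym perm_sort.
pose v' := [seq (x - size u)%N | x <- v].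
have pv' : perm_eq v' (iota 1 (size v')).
  rewrite size_map; have := perm_map (fun x => (x - size u)%N) pv.
  rewrite addnC iotaDl -map_comp -/v'.
  by rewrite (@eq_map _ _ _ id) ?map_id // => x /=; rewrite addKn.
exists (PermWord pu), (PermWord pv'); split=> //.
apply: word_inj; rewrite word_dsum epuv /=; congr (_ ++ _)%SEQ.
rewrite -map_comp -[LHS]map_id; apply/eq_in_map => x /=.
by rewrite (perm_mem pv) mem_iota add1n => /andP[ux _]; rewrite subnK // ltnW.
Qed.

(** Equidivisibility of the monoid: two factorizations of the same permutation
    have a common refinement.  As [a] is a prefix of [c], the remaining letters of
    [c] are shifted letters of [b], so [c] itself splits after [a]. *)
Lemma dsum_equidivisible (a b c d : permword) :
  dsum a b = dsum c d -> (size a <= size c)%N ->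
  exists2 e, c = dsum a e & b = dsum e d.
Proof.
move=> eabcd leac; have := congr1 word eabcd; rewrite !word_dsum => ew.
have ec : word c = (word a ++ take (size c - size a)
                      [seq (x + size a)%N | x <- word b])%SEQ.
  rewrite -[LHS](take_size_cat [seq (x + size c)%N | x <- word d] (erefl _)) -ew.
  by rewrite take_cat ltnNge leac.
have [x y xa|a' [e [ea' ec']]] := split_dsum _ _ _ ec.
  case/mem_take/mapP => z; rewrite mem_permword => /andP[z0 _] ->.
  move: xa; rewrite mem_permword => /andP[_ xa].
  by apply: leq_ltn_trans xa _; rewrite -{1}[size a]add0n ltn_add2r.
rewrite (word_inj _ _ ea') in ec'.
exists e => //; apply: (dsumpI a).
by rewrite eabcd ec' dsumA.
Qed.

(** * Indecomposable summands *)

Definition indecs (q : seq permword) := forall s, s \in q -> indecomposable s.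

Lemma indecs_cons (x : permword) (q : seq permword) :
  indecs (x :: q) -> indecomposable x /\ indecs q.
Proof.
move=> h; split=> [|s sq]; apply: h; rewrite ?mem_head //.
by rewrite inE sq orbT.
Qed.

Lemma indecomposable_dsum (a b : permword) :
  indecomposable (dsum a b) -> a = emptyp \/ b = emptyp.
Proof.
case=> _ nab; have [->|/eqP a0] := eqVneq a emptyp; first by left.
have [->|/eqP b0] := eqVneq b emptyp; first by right.
by case: nab; exists a, b.
Qed.

Lemma exists_finest_decomposition (p : permword) :
  exists q, finest_decomposition p q.
Proof.
have [n] := ubnP (size p); elim: n p => // n IH p; rewrite ltnS => pn.
have [->|/eqP p0] := eqVneq p emptyp; first by exists [::].
have [[a [b [a0 b0 epab]]]|nab] :=
  classic (exists a b, [/\ a <> emptyp, b <> emptyp & p = dsum a b]).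
- have ltpos (c : permword) : c <> emptyp -> (0 < size c)%N.
    by move=> /eqP; rewrite lt0n size_eq0_emptyp.
  have sp : size p = (size a + size b)%N by rewrite epab size_dsum.
  have [|qa [ea ha]] := IH a.
    by apply: leq_trans pn; rewrite sp -addn1 leq_add2l ltpos.
  have [|qb [eb hb]] := IH b.
    by apply: leq_trans pn; rewrite sp -add1n leq_add2r ltpos.
  exists (qa ++ qb)%SEQ; split; first by rewrite dsums_cat -ea -eb.
  by move=> s; rewrite mem_cat => /orP[/ha|/hb].
- exists [:: p]; split; first by rewrite /= dsump0.
  by move=> s; rewrite inE => /eqP ->; split.
Qed.

(** Every factorization of a direct sum of indecomposables cuts it between two
    summands; the uniqueness of the finest decomposition is contained in this. *)
Lemma dsums_eq_dsum (q : seq permword) (a b : permword) :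
  indecs q -> dsums q = dsum a b ->
  exists k, a = dsums (take k q) /\ b = dsums (drop k q).
Proof.
elim: q a b => [|x q IH] a b hq /=.
  move=> /(congr1 (fun p : permword => size p)); rewrite size_dsum /= => /esym/eqP.
  rewrite addn_eq0 !size_eq0_emptyp => /andP[/eqP -> /eqP ->].
  by exists 0%N.
have [ix {}hq] := indecs_cons _ _ hq; move=> eab.
have [le|/ltnW le] := leqP (size a) (size x).
  have [e ex eb] := dsum_equidivisible _ _ _ _ (esym eab) le.
  move: ix; rewrite ex => /indecomposable_dsum[] e0; last first.
    by exists 1%N; rewrite /= take0 drop0 eb e0 !dsump0 dsum0p.
  by exists 0%N; rewrite /= eb e0 dsum0p.
have [e ea eqb] := dsum_equidivisible _ _ _ _ eab le.
have [k [ee eb]] := IH _ _ hq eqb; exists k.+1.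
by rewrite ea ee.
Qed.

Lemma dsums_eq_indecomposable (q : seq permword) (t : permword) :
  indecs q -> indecomposable t -> dsums q = t -> q = [:: t].
Proof.
case: q => [|x [|y q]] hq it /= e.
- by case: it => t0 _; case: t0.
- by rewrite -e dsump0.
have [[x0 _] /indecs_cons[[y0 _] _]] := indecs_cons _ _ hq.
move: it; rewrite -e => /indecomposable_dsum[//|] /eqP.
rewrite -size_eq0_emptyp size_dsum addn_eq0 size_eq0_emptyp => /andP[/eqP //].
Qed.

(** * Containment in a direct sum *)

Lemma emptyp_le (p : permword) : (emptyp <= p)%O.
Proof. by apply/containedP; exists [::]; rewrite ?sub0seq // order_iso_refl. Qed.

Lemma nth_shift (n i : nat) (w : seq nat) :
  (i < size w)%N -> nth 0%N [seq (x + n)%N | x <- w] i = (nth 0%N w i + n)%N.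
Proof. by move=> h; rewrite (nth_map 0%N). Qed.

Lemma order_iso_cat (u u' v v' : seq nat) :
  (forall x y, x \in u -> y \in v -> (x < y)%N) ->
  (forall x y, x \in u' -> y \in v' -> (x < y)%N) ->
  order_iso u u' -> order_iso v v' -> order_iso (u ++ v) (u' ++ v').
Proof.
move=> ltuv ltuv' /order_isoP[eu hu] /order_isoP[ev hv].
apply/order_isoP; split; first by rewrite !size_cat eu ev.
move=> i j; rewrite size_cat !nth_cat -!eu => hi hj.
case: (ltnP i (size u)) => iu; case: (ltnP j (size u)) => ju.
- exact: hu.
- have jv : (j - size u < size v)%N by rewrite ltn_subLR.
  by rewrite ltuv ?ltuv' ?mem_nth -?eu -?ev.
- have iv : (i - size u < size v)%N by rewrite ltn_subLR.
  rewrite [LHS]ltnNge [RHS]ltnNge ltnW ?ltuv ?mem_nth //.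
  by rewrite ltnW ?ltuv' ?mem_nth -?eu -?ev.
- by apply: hv; rewrite ltn_subLR.
Qed.

Lemma order_iso_shift (n : nat) (w : seq nat) :
  order_iso w [seq (x + n)%N | x <- w].
Proof.
apply/order_isoP; rewrite size_map; split=> // i j hi hj.
by rewrite !nth_shift // ltn_add2r.
Qed.

Lemma order_iso_sym (u v : seq nat) : order_iso u v -> order_iso v u.
Proof.
move=> /order_isoP[e h]; apply/order_isoP; split=> // i j hi hj.
by rewrite h ?e.
Qed.

Lemma order_iso_take (k : nat) (u v : seq nat) :
  order_iso u v -> order_iso (take k u) (take k v).
Proof.
move=> /order_isoP[e h]; apply/order_isoP; rewrite !size_take_min e; split=> // i j.
by rewrite !leq_min => /andP[ik iv] /andP[jk jv]; rewrite !nth_take // h // e.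
Qed.

Lemma order_iso_drop (k : nat) (u v : seq nat) :
  order_iso u v -> order_iso (drop k u) (drop k v).
Proof.
move=> /order_isoP[e h]; apply/order_isoP; rewrite !size_drop e; split=> // i j hi hj.
by rewrite !nth_drop h // e -ltn_subRL.
Qed.

Lemma lt_shift (s r : permword) (u v : seq nat) :
  subseq u (word s) -> subseq v (word r) ->
  forall x y, x \in u -> y \in [seq (z + size s)%N | z <- v] -> (x < y)%N.
Proof.
move=> us vr x y /(mem_subseq us); rewrite mem_permword => /andP[_ xs].
case/mapP=> z /(mem_subseq vr); rewrite mem_permword => /andP[z0 _] ->.
by apply: leq_ltn_trans xs _; rewrite -{1}[size s]add0n ltn_add2r.
Qed.

Lemma le_dsum (a b s r : permword) :
  (a <= s)%O -> (b <= r)%O -> (dsum a b <= dsum s r)%O.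
Proof.
move=> /containedP[u us au] /containedP[v vr bv]; apply/containedP.
exists (u ++ [seq (x + size s)%N | x <- v])%SEQ; rewrite word_dsum.
  by apply: cat_subseq => //; apply: map_subseq.
apply: order_iso_cat => //; first exact: (lt_shift a b).
  exact: (lt_shift s r).
apply: order_iso_trans (order_iso_sym _ _ (order_iso_shift _ _)) _.
exact: order_iso_trans bv (order_iso_shift _ _).
Qed.

(** An occurrence of [p] in [dsum s r] has a part in [s] followed by a part in
    [r], the letters of the former being below those of the latter, so that
    [split_dsum] applies to [p] itself. *)
Lemma le_dsum_split (p s r : permword) :
  (p <= dsum s r)%O ->
  exists a b, [/\ p = dsum a b, (a <= s)%O & (b <= r)%O].
Proof.
move=> /containedP[w]; rewrite word_dsum => /subseqP[m sm ->] pw.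
move: sm; rewrite size_cat size_map => sm.
pose m1 := take (size s) m; pose m2 := drop (size s) m.
(* The mask selecting the occurrence is cut where [s] ends. *)
have sm1 : size m1 = size s by rewrite size_takel // sm leq_addr.
rewrite -(cat_take_drop (size s) m) mask_cat // -map_mask -/m1 -/m2 in pw.
set u := mask m1 s in pw; set v := mask m2 r in pw.
set v' := [seq _ | x <- v] in pw.
have us : subseq u s := mask_subseq _ _.
have vr : subseq v r := mask_subseq _ _.
pose k := size u.
have iu : order_iso (take k p) u.
  by have := order_iso_take k _ _ pw; rewrite take_size_cat.
have iv : order_iso (drop k p) v'.
  by have := order_iso_drop k _ _ pw; rewrite drop_size_cat.
have [x y|a [b [ea epab]]] := split_dsum _ _ _ (esym (cat_take_drop k (word p))).
  have [ep hp] := order_isoP _ _ pw.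
  have kp : (k <= size p)%N by rewrite ep size_cat leq_addr.
  move=> /(nthP 0%N)[i hi <-] /(nthP 0%N)[j hj <-].
  rewrite size_takel // in hi; rewrite size_drop in hj.
  rewrite nth_take // nth_drop hp; last 2 first.
  - exact: leq_trans hi kp.
  - by rewrite -ltn_subRL.
  rewrite !nth_cat -/k hi (ltnNge (k + j)) leq_addr /= addKn.
  apply: (lt_shift s r u v) => //; apply: mem_nth => //.
  by move: hj; rewrite ep size_cat -/k addKn.
exists a, b; split=> //.
  by apply/containedP; exists u; rewrite // ea.
apply/containedP; exists v => //.
have eb : drop k p = [seq (x + size a)%N | x <- word b].
  have /eqP := congr1 word epab.
  rewrite word_dsum -{1}(cat_take_drop k (word p)) -ea.
  by rewrite eqseq_cat // eqxx => /eqP.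
rewrite eb in iv.
apply: order_iso_trans (order_iso_shift (size a) _) _.
exact: order_iso_trans iv (order_iso_sym _ _ (order_iso_shift _ _)).
Qed.

Lemma dsums_le_dsum (q : seq permword) (s r : permword) :
  indecs q ->
  (dsums q <= dsum s r)%O <->
  exists k, (dsums (take k q) <= s)%O /\ (dsums (drop k q) <= r)%O.
Proof.
move=> hq; split=> [/le_dsum_split[a [b [eab las lbr]]]|[k [ls lr]]].
  by have [k [ea eb]] := dsums_eq_dsum _ _ _ hq eab; exists k; rewrite -ea -eb.
by rewrite -(cat_take_drop k q) dsums_cat le_dsum.
Qed.

(** * Moebius inversion *)

(** The defining recursion: Moebius times zeta is the identity. *)
Lemma mobius_zeta (s r t : permword) : (r <= t)%O ->
  \sum_(p <- down t) mobius s p * (p <= r)%O%:R = (s == r)%:R.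
Proof.
move=> rt.
transitivity (\sum_(p <- down r) mobius s p).
  rewrite (eq_bigr (fun p => if (p <= r)%O then mobius s p else 0)); last first.
    by move=> p _; case: ifP => _; rewrite ?mulr1 ?mulr0.
  rewrite -big_mkcond -big_filter; apply: perm_big.
  apply: uniq_perm (filter_uniq _ (uniq_down t)) (uniq_down r) _ => p.
  rewrite mem_filter !mem_down; case: (boolP (p <= r)%O) => // pr.
  by rewrite (le_trans pr rt).
have rr : r \in down r by rewrite mem_down.
rewrite (bigD1_seq r) ?uniq_down //=.
have [->|sr] := eqVneq s r.
  rewrite mobiusxx big_seq_cond big1 ?addr0 // => p; rewrite mem_down => /andP[pr npr].
  by apply: mobius_nle; apply: contra npr => rp; rewrite eq_le pr rp.
have [lsr|nsr] := boolP (s <= r)%O; last first.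
  rewrite mobius_nle // add0r big_seq_cond big1 // => p.
  rewrite mem_down => /andP[pr _]; apply: mobius_nle.
  by apply: contra nsr => sp; apply: le_trans sp pr.
rewrite mobius_lt ?lt_neqAle ?sr //.
apply/eqP; rewrite addrC subr_eq0; apply/eqP.
rewrite big_seq_cond [RHS]big_seq_cond.
rewrite [LHS](bigID (fun p => (s <= p)%O)) /= addrC big1 ?add0r; last first.
  by move=> p /andP[_ nsp]; rewrite mobius_nle.
apply: eq_bigl => p; rewrite mem_down lt_neqAle.
by case: (p <= r)%O; rewrite /= ?andbF // andbC andbT.
Qed.

(** The dual equations, zeta times Moebius.  In the finite interval below [t] the
    two functions are square matrices, for which a left inverse is a right
    inverse. *)
Lemma zeta_mobius (p t : permword) :
  \sum_(s <- down t) mobius s t * (p <= s)%O%:R = (p == t)%:R.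
Proof.
have [pt|npt] := boolP (p <= t)%O; last first.
  rewrite (_ : (p == t) = false); last by apply: contraNF npt => /eqP ->.
  rewrite big_seq big1 // => s; rewrite mem_down => st.
  rewrite (_ : (p <= s)%O = false) ?mulr0 //.
  by apply: contraNF npt => ps; apply: le_trans ps st.
pose n := size (down t); pose d (i : 'I_n) := nth emptyp (down t) i.
have dt i : (d i <= t)%O by rewrite -mem_down mem_nth.
have d_inj i j : (d i == d j) = (i == j).
  by rewrite nth_uniq ?uniq_down.
have sum_d (F : permword -> int) : \sum_(s <- down t) F s = \sum_i F (d i).
  by rewrite (big_nth emptyp) big_mkord.
have dP s : (s <= t)%O -> exists i, s = d i.
  rewrite -mem_down => st; have si : (index s (down t) < n)%N by rewrite index_mem.
  by exists (Ordinal si); rewrite /d nth_index.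
have /mulmx1C/matrixP inv : \matrix_(i, j) mobius (d i) (d j) *m
    \matrix_(i, j) (d i <= d j)%O%:R = 1%:M.
  apply/matrixP => i j; rewrite !mxE -d_inj -(mobius_zeta _ _ t) // sum_d.
  by apply: eq_bigr => k _; rewrite !mxE.
have [i ei] := dP _ pt; have [j ej] := dP _ (lexx t).
have := inv i j; rewrite !mxE -d_inj -ei -ej => <-; rewrite sum_d.
by apply: eq_bigr => k _; rewrite !mxE -ei -ej mulrC.
Qed.

(** The dual equations determine the Moebius function, because the zeta matrix is
    invertible: multiply them by the Moebius matrix on the left. *)
Lemma mobius_unique (t : permword) (f : permword -> int) :
  (forall s, ~~ (s <= t)%O -> f s = 0) ->
  (forall p, \sum_(s <- down t) f s * (p <= s)%O%:R = (p == t)%:R) ->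
  forall s, f s = mobius s t.
Proof.
move=> f0 hf s; have [st|nst] := boolP (s <= t)%O; last first.
  by rewrite f0 // mobius_nle.
have delta (g : permword -> int) (x : permword) : (x <= t)%O ->
    \sum_(r <- down t) g r * (x == r)%:R = g x.
  move=> xt; rewrite (bigD1_seq x) ?mem_down ?uniq_down //= eqxx mulr1.
  rewrite big1 ?addr0 // => r; rewrite eq_sym => /negbTE ->.
  by rewrite mulr0.
rewrite -(delta f) // -(delta (mobius s)) //.
transitivity (\sum_(r <- down t) \sum_(p <- down t)
                mobius s p * (f r * (p <= r)%O%:R)).
  rewrite big_seq [RHS]big_seq; apply: eq_bigr => r; rewrite mem_down => rt.
  rewrite -(mobius_zeta _ _ t) // mulr_sumr; apply: eq_bigr => p _.
  by rewrite mulrCA.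
rewrite exchange_big; apply: eq_bigr => p _.
by rewrite -mulr_sumr hf eq_sym.
Qed.

(** * The contribution of one indecomposable summand *)

(** The summation over one summand.  The number [k0] of the proof is the least k
    such that [r] contains what remains of [q] after its first k entries; the
    remainder goes to [r] and [dsums (take k0 q)] has to be found in [s].  By the
    dual Moebius equations the sum is 1 if [take k0 q] is [:: t] and 0 otherwise;
    the difference on the right-hand side says that [k0] is 1. *)
Lemma zeta_mobius_dsum (t r : permword) (q : seq permword) :
  indecomposable t -> indecs q ->
  \sum_(s <- down t) mobius s t * (dsums q <= dsum s r)%O%:R =
  if head emptyp q == t
  then (dsums (behead q) <= r)%O%:R - (dsums q <= r)%O%:R else 0.
Proof.
move=> it hq; pose P k := (dsums (drop k q) <= r)%O.
have exP : exists k, P k by exists (size q); rewrite /P drop_size emptyp_le.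
have Pmono k l : (k <= l)%N -> P k -> P l.
  move=> kl; apply: le_trans; rewrite -(subnK kl) -drop_drop.
  rewrite -[X in (_ <= dsums X)%O](cat_take_drop (l - k)) dsums_cat.
  by rewrite -[X in (X <= _)%O]dsum0p le_dsum ?emptyp_le.
case: (ex_minnP exP) => k0 Pk0 mink0.
have takeE s : (dsums q <= dsum s r)%O = (dsums (take k0 q) <= s)%O.
  apply/idP/idP => [/dsums_le_dsum[//|k [ks kr]]|h]; last first.
    by apply/dsums_le_dsum => //; exists k0.
  apply: le_trans ks; rewrite -(subnKC (mink0 _ kr)) takeD dsums_cat.
  by rewrite -[X in (X <= _)%O]dsump0 le_dsum ?emptyp_le.
under eq_bigr do rewrite takeE.
rewrite zeta_mobius.
have Pk k : P k = (k0 <= k)%N by apply/idP/idP => [/mink0|/Pmono/(_ Pk0)].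
have := Pk 1%N; have := Pk 0%N; rewrite /P drop0 drop1 => -> ->.
have k0q : (k0 <= size q)%N by rewrite -Pk /P drop_size emptyp_le.
have [t0 _] := it.
clear - hq it t0 k0q.
case: q k0 hq k0q => [|x q] [|[|k]] hq k0q //=.
- by rewrite eq_sym (negbTE (introN eqP t0)).
- by rewrite eq_sym (negbTE (introN eqP t0)) subrr if_same.
- by rewrite take0 dsump0 subr0; case: ifP.
rewrite subrr if_same; case: eqP => // e.
have htake : indecs (take k.+2 (x :: q)) by move=> s /mem_take; apply: hq.
have /(congr1 size) := dsums_eq_indecomposable _ _ htake it e.
by rewrite size_takel.
Qed.

(** * The sum over all the decompositions *)

(** The factor of the theorem for the summand [s] below [t], where [prev] is the
    summand before [t].  Indecomposables being nonempty, [prev = emptyp] stands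
    for the absence of a previous summand. *)
Definition weight (prev t s : permword) : int :=
  mobius s t + ((s == emptyp) && (prev == t))%:R.

Definition weights (prev : permword) (ts ss : seq permword) : int :=
  \prod_(m < size ts)
    weight (nth emptyp (prev :: ts) m) (nth emptyp ts m) (nth emptyp ss m).

Definition zeta_weights (prev : permword) (q ts : seq permword) : int :=
  \sum_(ss <- down_seqs ts) weights prev ts ss * (dsums q <= dsums ss)%O%:R.

Lemma zeta_weights_nil (prev : permword) (q : seq permword) :
  indecs q -> zeta_weights prev q [::] = (q == [::])%:R.
Proof.
move=> hq; rewrite /zeta_weights /= big_seq1 /weights big_ord0 mul1r; congr ((nat_of_bool _)%:R).
case: q hq => [|x q] hq /=; first by rewrite emptyp_le.
have [[x0 _] _] := indecs_cons _ _ hq; apply/negbTE/negP.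
move=> /contained_size; rewrite size_dsum leqn0 addn_eq0 size_eq0_emptyp.
by case/andP => /eqP.
Qed.

Lemma zeta_weights_cons (prev t : permword) (q ts : seq permword) :
  indecomposable t -> indecs q ->
  zeta_weights prev q (t :: ts) =
  (if head emptyp q == t
   then zeta_weights t (behead q) ts - zeta_weights t q ts else 0)
  + (prev == t)%:R * zeta_weights t q ts.
Proof.
move=> it hq; rewrite /zeta_weights /= big_allpairs_dep exchange_big /=.
have step ss : \sum_(s <- down t) weights prev (t :: ts) (s :: ss) *
      (dsums q <= dsum s (dsums ss))%O%:R =
    weights t ts ss *
    ((if head emptyp q == t
      then (dsums (behead q) <= dsums ss)%O%:R - (dsums q <= dsums ss)%O%:R
      else 0) + (prev == t)%:R * (dsums q <= dsums ss)%O%:R).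
  rewrite -zeta_mobius_dsum //.
  (* The extra +1 contributes only through the empty summand. *)
  have -> : (prev == t)%:R * (dsums q <= dsums ss)%O%:R =
      \sum_(s <- down t) ((s == emptyp) && (prev == t))%:R *
        (dsums q <= dsum s (dsums ss))%O%:R :> int.
    rewrite (bigD1_seq emptyp) ?mem_down ?emptyp_le ?uniq_down //= dsum0p.
    rewrite big1 ?addr0 // => s /negbTE ->.
    by rewrite mul0r.
  rewrite -big_split /= mulr_sumr; apply: eq_bigr => s _.
  rewrite -mulrDl -[_ + _]/(weight prev t s) mulrA [X in _ = X * _]mulrC.
  by rewrite /weights big_ord_recl.
under eq_bigr do rewrite step.
case: ifP => _.
  rewrite mulr_sumr -sumrB -big_split; apply: eq_bigr => ss _ /=.
  by rewrite mulrDr mulrBr mulrCA.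
rewrite add0r mulr_sumr; apply: eq_bigr => ss _.
by rewrite add0r mulrCA.
Qed.

(** This is where the correction terms +1 are needed.  If [ts] starts with [u],
    the recursion gives, for the first sum, the wanted difference (when [q] starts
    with [u]) plus [t = u] times the sum for [q]; for the second one, [t = u] times
    a difference in which the sum for [t :: q] is cancelled by the correction,
    leaving [t = u] times the sum for [q].  So only the wanted difference
    survives. *)
Lemma zeta_weights_telescope (t : permword) (q ts : seq permword) :
  indecs (t :: q) -> indecs ts ->
  zeta_weights t q ts - zeta_weights t (t :: q) ts = (q == ts)%:R.
Proof.
elim: ts t q => [|u ts IH] t q htq hts.
  have [_ hq] := indecs_cons _ _ htq.
  by rewrite !zeta_weights_nil // subr0.
have [it hq] := indecs_cons _ _ htq; have [iu {}hts] := indecs_cons _ _ hts.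
rewrite !zeta_weights_cons //=.
have -> : (if t == u then zeta_weights u q ts - zeta_weights u (t :: q) ts else 0) =
    (t == u)%:R * (zeta_weights u q ts - zeta_weights u (t :: q) ts).
  by case: (t == u); rewrite ?mul1r ?mul0r.
rewrite -mulrDr subrK addrK.
case: q hq {htq} => [|x q] hq /=.
  by case: eqP => // e; case: iu; rewrite e.
have [<-|xu] := eqVneq x u; last by rewrite eqseq_cons (negbTE xu).
by rewrite IH // eqseq_cons eqxx.
Qed.

Lemma zeta_weights_first (q ts : seq permword) :
  indecs q -> indecs ts -> zeta_weights emptyp q ts = (q == ts)%:R.
Proof.
case: ts => [|t ts] hq hts; first exact: zeta_weights_nil.
have [it {}hts] := indecs_cons _ _ hts; have [/eqP t0 _] := it.
rewrite zeta_weights_cons // [emptyp == t]eq_sym (negbTE t0) mul0r addr0.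
case: q hq => [|x q] hq /=; first by rewrite [emptyp == t]eq_sym (negbTE t0).
have [ext|xt] := eqVneq x t; last by rewrite eqseq_cons (negbTE xt).
by rewrite -ext zeta_weights_telescope ?eqseq_cons ?eqxx // ext.
Qed.

Lemma dsums_le (ss ts : seq permword) :
  ss \in down_seqs ts -> (dsums ss <= dsums ts)%O.
Proof.
rewrite mem_down_seqs; elim: ss ts => [|s ss IH] [|t ts] //= /andP[st /IH].
exact: le_dsum.
Qed.

(* The summands tau_1, ..., tau_t are indexed from 0 in the sequence [taus]. *)
Theorem proposition8p1 (sigma tau : permword) (taus : seq permword)
    (htau : finest_decomposition tau taus) :
  mobius sigma tau =
  \sum_(ss <- down_seqs taus | dsums ss == sigma)
    \prod_(m < size taus)
      (if [&& nth emptyp ss m == emptyp, (0 < m)%N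
            & nth emptyp taus m.-1 == nth emptyp taus m]
       then mobius (nth emptyp ss m) (nth emptyp taus m) + 1
       else mobius (nth emptyp ss m) (nth emptyp taus m)).
Proof.
have [etau htaus] := htau.
transitivity (\sum_(ss <- down_seqs taus | dsums ss == sigma)
                 weights emptyp taus ss); last first.
  apply: eq_bigr => ss _; apply: eq_bigr => -[m mt] _; rewrite /weight /=.
  have {}mt : nth emptyp taus m \in taus := mem_nth _ mt.
  have [/eqP t0 _] := htaus _ mt.
  case: m mt t0 => [|m] mt t0 /=.
    by rewrite [emptyp == _]eq_sym (negbTE t0) andbF addr0.
  by case: ifP; rewrite ?addr0.
pose f s : int := \sum_(ss <- down_seqs taus | dsums ss == s) weights emptyp taus ss.
symmetry; apply: (mobius_unique tau f) => [s nst|p].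
  rewrite /f big_seq_cond big1 // => ss /andP[/dsums_le].
  by rewrite -etau => le /eqP es; rewrite -es le in nst.
(* For [p = tau], the decomposition [taus] itself is used. *)
have [q [[ep hq] eq_pq]] : exists q,
    finest_decomposition p q /\ (p == tau) = (q == taus).
  have [->|pt] := eqVneq p tau; first by exists taus; rewrite eqxx.
  have [q [ep hq]] := exists_finest_decomposition p; exists q; split=> //.
  by apply/esym/negbTE; apply: contraNneq pt => eq; rewrite ep etau eq.
rewrite eq_pq -zeta_weights_first // /zeta_weights /f.
under eq_bigr do rewrite mulr_suml.
rewrite (exchange_big_dep xpredT) //= big_seq [RHS]big_seq.
apply: eq_bigr => ss /dsums_le; rewrite -etau => le.
rewrite big_mkcond (bigD1_seq (dsums ss)) ?mem_down ?uniq_down //= eqxx -ep.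
by rewrite big1 ?addr0 // => s; rewrite eq_sym => /negbTE ->.
Qed.
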